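(* Let $A\in\mathbb{C}$ and let $$S(z)=\frac{z^3\left((A-1)z+2A-1\right)}{(2A-1)z+A-1}.$$ The strange fixed points $$z_{2,3}=\frac{3A-2\pm\sqrt{A(5A-4)}}{2(1-A)}$$ of $S$ satisfy the following statements: 1. If $\left|A-\frac{29}{35}\right|<\frac{1}{35}$, then $z_2$ and $z_3$ are attractors and, in particular, they are superattractors for $A=\frac56$. 2. If $\left|A-\frac{29}{35}\right|=\frac{1}{35}$, then $z_2$ and $z_3$ are parabolic fixed points. 3. If $A\neq 0$, $A\neq 1$ and $\left|A-\frac{29}{35}\right|>\frac{1}{35}$, then $z_2$ and $z_3$ are repulsive fixed points.
   Context: $S$ is regarded as a rational map of the Riemann sphere $\widehat{\mathbb{C}}$, depending on the complex parameter $A$ (common factors of numerator and denominator, when present, are cancelled). The symbol $\sqrt{A(5A-4)}$ denotes a complex square root; $z_2,z_3$ correspond to the two signs. A point $z_0$ is a fixed point of a rational map $R$ if $R(z_0)=z_0$. A fixed point $z_0$ is called an attractor if $|R'(z_0)|<1$, repulsive if $|R'(z_0)|>1$, parabolic (or neutral) if $|R'(z_0)|=1$, and a superattractor if $|R'(z_0)|=0$. $S$ is the map conjugate, via $M(z)=\frac{z-a}{z-b}$, to a root-finding iteration applied to $(z-a)(z-b)$, $a\ne b$, so that the roots $a,b$ correspond to the fixed points $0$ and $\infty$ of $S$; ''strange fixed point'' means a fixed point not associated with the roots, i.e. a fixed point of $S$ different from $0$ and $\infty$. *)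

(* Defs.v *)
From mathcomp Require Export all_boot all_order all_algebra complex.
From mathcomp Require Export boolp classical_sets reals topology normedtype.
From mathcomp Require Export derive.

Set Implicit Arguments.
Unset Strict Implicit.
Unset Printing Implicit Defensive.

Import Order.TTheory GRing.Theory Num.Theory.
Import numFieldNormedType.Exports.

Local Open Scope ring_scope.

(* The definitions are generic in a number field K with its metric topology;
   for K = R[i] with R : realType, [sphere K] is the Riemann sphere. *)
Section RationalMaps.
Variable K : numFieldType.

(* [Some z] is the finite point z and [None] is the point at infinity. *)
Definition sphere : Type := one_point_compactification K.
Definition fin (z : K) : sphere := Some z.
Definition infty : sphere := None.

(* The self-map of the sphere induced by p / q (q != 0), after cancelling the
   greatest common divisor.  At infinity, the value is given by the comparison
   of the degrees. *)
Definition ratmap (p q : {poly K}) (x : sphere) : sphere :=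
  let p0 := p %/ gcdp p q in
  let q0 := q %/ gcdp p q in
  match x with
  | Some z => if q0.[z] == 0 then infty else fin (p0.[z] / q0.[z])
  | None =>
      if (size q0 < size p0)%N then infty
      else if (size p0 < size q0)%N then fin 0
      else fin (lead_coef p0 / lead_coef q0)
  end.

(* f read in the affine coordinate; the value 0 at poles is irrelevant in the
   neighbourhood of a finite fixed point of a rational map. *)
Definition affine (f : sphere -> sphere) (z : K) : K :=
  if f (fin z) is Some w then w else 0.

Definition fixed_point (f : sphere -> sphere) (x : sphere) : Prop := f x = x.

Definition strange_fixed_point (f : sphere -> sphere) (x : sphere) : Prop :=
  [/\ fixed_point f x, x <> fin 0 & x <> infty].

(* Differentiability is required explicitly, because [derive1] has a default
   value at the points where the limit does not exist. *)
Definition fixed_point_multiplier (f : sphere -> sphere) (z : K)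
    (P : K -> Prop) : Prop :=
  [/\ fixed_point f (fin z), derivable (affine f) z 1
    & P (derive1 (affine f) z)].

Definition attractor (f : sphere -> sphere) (z : K) : Prop :=
  fixed_point_multiplier f z (fun m => `|m| < 1).

Definition repulsive (f : sphere -> sphere) (z : K) : Prop :=
  fixed_point_multiplier f z (fun m => 1 < `|m|).

Definition parabolic (f : sphere -> sphere) (z : K) : Prop :=
  fixed_point_multiplier f z (fun m => `|m| = 1).

Definition superattractor (f : sphere -> sphere) (z : K) : Prop :=
  fixed_point_multiplier f z (fun m => `|m| = 0).

Definition S_num (A : K) : {poly K} :=
  'X^3 * ((A - 1)%:P * 'X + (2 * A - 1)%:P).

Definition S_den (A : K) : {poly K} := (2 * A - 1)%:P * 'X + (A - 1)%:P.

Definition S_map (A : K) : sphere -> sphere := ratmap (S_num A) (S_den A).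

End RationalMaps.

(* Main.v *)
Require Import Defs.
From mathcomp Require Import functions ring.
Import Order.TTheory GRing.Theory Num.Theory.
Import numFieldNormedType.Exports.
Local Open Scope ring_scope.
Local Open Scope complex_scope.

(** With a = A - 1 and c = 2A - 1, the equation S(z) = z becomes, away from
    z = 0 and after clearing the denominator c z + a,
      (z - 1) (a z^2 + (a + c) z + a) = 0,
    and the discriminant of the quadratic factor is A (5A - 4), so z2 and z3
    are its two roots; they are not 0 because a is not 0.

    Modulo that quadratic, z^2 + 1 = - (a + c) z / a.  This collapses the
    numerator of S'(z) to z^3 (4a + c) (a - c), and (c z + a)^2 to
    a z^3 (a - c), so that both fixed points have the same multiplier
      S'(z) = (4a + c) / a = (6A - 5) / (A - 1)
    as soon as A = c - a is not 0 ([is_derive_S_strange]).  It vanishes at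
    A = 5/6, and comparing its modulus with 1 is a comparison with an
    Apollonius circle:
      |6A - 5|^2 - |A - 1|^2 = 35 (|A - 29/35|^2 - (1/35)^2)
    ([multiplier_normE]), from which the three regimes follow.

    The denominator c z + a vanishes at a root of the quadratic only if A = 0.
    There S cancels to z^3 and z2 = z3 = -1, which is still a strange fixed
    point, but whose multiplier is 3 rather than 5; the closed disk around
    29/35 of radius 1/35 avoids both A = 0 and A = 1 ([disk_neq01]). *)

(** * Values and derivatives of maps of the sphere given by fractions *)

Section RationalMapDerivative.
Local Set Implicit Arguments.
Local Unset Strict Implicit.
Variable K : numFieldType.
Implicit Types (p q : {poly K}) (z : K).

Lemma is_derive_horner p z : is_derive z (1 : K) (horner p) p^`().[z].
Proof.
elim/poly_ind: p => [|p c IHp].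
  have -> : horner (0 : {poly K}) = cst 0 by apply/funext => y; rewrite horner0.
  by rewrite deriv0 horner0; exact: is_derive_cst.
have -> : horner (p * 'X + c%:P) = horner p * id + cst c.
  by apply/funext => y; rewrite !hornerE.
apply: is_derive_eq.
rewrite derivD derivM derivX derivC !hornerE /=.
by rewrite /GRing.scale /= mulr1 addrC mulrC.
Qed.

Lemma near_horner_neq0 q z : q.[z] != 0 -> \near z, q.[z] != 0.
Proof.
move=> qz0.
have /derivable1_diffP/differentiable_continuous qc : derivable (horner q) z 1.
  by case: (is_derive_horner q z).
exact: cvgr_neq0 qc qz0.
Qed.

Lemma is_derive_rational p q z : q.[z] != 0 ->
  is_derive z (1 : K) (fun w => p.[w] / q.[w])
    ((p^`().[z] * q.[z] - p.[z] * q^`().[z]) / q.[z] ^+ 2).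
Proof.
move=> qz0.
have [dp dpE] := is_derive_horner p z.
have [dq dqE] := is_derive_horner q z.
have dV : is_derive z (1 : K) (fun w => (q.[w])^-1)
    (- q.[z] ^- 2 *: q^`().[z]).
  by apply: DeriveDef; [exact: derivableV | rewrite deriveV // dqE].
have dM := is_deriveM (DeriveDef dp dpE) dV.
apply: (is_derive_eq dM); rewrite /GRing.scale /=; field; exact: qz0.
Qed.

(** The cancelled fraction can be evaluated on any other representative of the
    same fraction whose denominator is nonzero at the point.  This handles the
    uncancelled fraction and a fraction simplified by hand on the same
    footing, without computing a gcd: if the reduced denominator vanished at z,
    so would the reduced numerator, against coprimality. *)
Lemma ratmap_fin p q p1 q1 z : q != 0 -> p * q1 = p1 * q -> q1.[z] != 0 ->
  ratmap p q (fin z) = fin (p1.[z] / q1.[z]).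
Proof.
move=> q_neq0 pq q1z; rewrite /ratmap /=.
have g_neq0 : gcdp p q != 0 by rewrite gcdp_eq0 negb_and q_neq0 orbT.
set p0 := p %/ gcdp p q; set q0 := q %/ gcdp p q.
have pE : p = p0 * gcdp p q by rewrite divpK // dvdp_gcdl.
have qE : q = q0 * gcdp p q by rewrite divpK // dvdp_gcdr.
have cop : coprimep p0 q0 by apply: coprimep_div_gcd; rewrite q_neq0 orbT.
have p0q1 : p0 * q1 = p1 * q0.
  by apply: (mulIf g_neq0); rewrite mulrAC -pE pq -mulrA -qE.
have p0q1z : p0.[z] * q1.[z] = p1.[z] * q0.[z] by rewrite -!hornerM p0q1.
have [q0z|q0z] := eqVneq q0.[z] 0.
  have /eqP := p0q1z; rewrite q0z mulr0 mulf_eq0 (negPf q1z) orbF => p0z.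
  have := coprimep_root cop p0z.
  by rewrite q0z eqxx.
by congr (Some _); apply/eqP; rewrite eqr_div // p0q1z.
Qed.

Lemma is_derive_affine_ratmap p q p1 q1 z :
    q != 0 -> p * q1 = p1 * q -> q1.[z] != 0 ->
  is_derive z (1 : K) (affine (ratmap p q))
    ((p1^`().[z] * q1.[z] - p1.[z] * q1^`().[z]) / q1.[z] ^+ 2).
Proof.
move=> q_neq0 pq q1z; apply: (near_eq_is_derive (f := fun w => p1.[w] / q1.[w])).
  near=> w; have q1w : q1.[w] != 0 by near: w; exact: near_horner_neq0.
  by rewrite /affine (ratmap_fin q_neq0 pq q1w).
exact: is_derive_rational.
Unshelve. all: by end_near.
Qed.

End RationalMapDerivative.

(** * The strange fixed points and their multiplier *)

Section StrangeFixedPoints.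
Local Set Implicit Arguments.
Local Unset Strict Implicit.
Variable K : numFieldType.
Implicit Types A s z : K.

(** The factor of the numerator of S(z) - z that remains after removing the
    fixed points 0 and 1. *)
Definition strange_quadratic A z : K :=
  (A - 1) * z ^+ 2 + (3 * A - 2) * z + (A - 1).

Lemma strange_quadratic_root A s z :
    A != 1 -> s ^+ 2 = A * (5 * A - 4) ->
    z = (3 * A - 2 + s) / (2 * (1 - A)) ->
  strange_quadratic A z = 0.
Proof.
move=> A1 hs ->; have A1' : 1 - A != 0 by rewrite subr_eq0 eq_sym.
rewrite /strange_quadratic.
rewrite [LHS](_ : _ = (A * (5 * A - 4) - s ^+ 2) / (4 * (1 - A))).
  by rewrite hs subrr mul0r.
by field.
Qed.

Lemma strange_quadratic_neq0 A z :
  A != 1 -> strange_quadratic A z = 0 -> z != 0.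
Proof.
move=> A1; apply: contra_eq_neq => ->.
by rewrite /strange_quadratic expr0n /= !mulr0 !add0r subr_eq0.
Qed.

Lemma S_denE A z : (S_den A).[z] = (2 * A - 1) * z + (A - 1).
Proof. by rewrite /S_den !hornerE. Qed.

Lemma S_numE A z : (S_num A).[z] = z ^+ 3 * ((A - 1) * z + (2 * A - 1)).
Proof. by rewrite /S_num !hornerE. Qed.

Lemma deriv_S_numE A z :
  (S_num A)^`().[z] = 4 * (A - 1) * z ^+ 3 + 3 * (2 * A - 1) * z ^+ 2.
Proof.
rewrite /S_num derivM derivD derivM derivXn derivX !derivC !hornerE.
by rewrite /=; ring.
Qed.

Lemma deriv_S_denE A z : (S_den A)^`().[z] = 2 * A - 1.
Proof. by rewrite /S_den derivD derivM derivX !derivC !hornerE. Qed.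

(** The denominator is the quadratic minus (A - 1) z (z + 1); this is what
    locates its possible zeros among the strange fixed points at z = -1. *)
Lemma S_den_strange A z : strange_quadratic A z = 0 ->
  (S_den A).[z] = - ((A - 1) * z * (z + 1)).
Proof.
rewrite S_denE => h; apply/eqP; rewrite -subr_eq0 -[X in _ == X]h.
by apply/eqP; rewrite /strange_quadratic; ring.
Qed.

(** At z = -1 the quadratic takes the value -A. *)
Lemma S_den_strange_neq0 A z : A != 0 -> A != 1 ->
  strange_quadratic A z = 0 -> (S_den A).[z] != 0.
Proof.
move=> A0 A1 h; have z0 := strange_quadratic_neq0 A1 h.
rewrite S_den_strange // oppr_eq0 !mulf_neq0 ?subr_eq0 //.
apply: contraNneq A0 => /eqP; rewrite addr_eq0 => /eqP zE.
rewrite -oppr_eq0 -[X in _ == X]h zE /strange_quadratic.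
by apply/eqP; ring.
Qed.

Lemma S_den_neq0 A : A != 1 -> S_den A != 0.
Proof.
move=> A1; apply/eqP => h; have /eqP := S_denE A 0.
by rewrite h horner0 mulr0 add0r eq_sym subr_eq0 (negPf A1).
Qed.

Lemma S_fixed_strange A z : A != 1 -> strange_quadratic A z = 0 ->
  fixed_point (S_map A) (fin z).
Proof.
move=> A1 h; have z0 := strange_quadratic_neq0 A1 h.
rewrite /fixed_point /S_map; have [A0|A0] := eqVneq A 0.
  (* S is then z^3 after cancellation, and -1 is the double root of the
     quadratic *)
  have zE : z = -1.
    have /eqP : (z + 1) ^+ 2 = - strange_quadratic A z.
      by rewrite A0 /strange_quadratic; ring.
    by rewrite h oppr0 sqrf_eq0 addr_eq0 => /eqP.
  have pq : S_num A * 1 = 'X^3 * S_den A.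
    by rewrite mulr1 A0 /S_num /S_den !mulr0 !sub0r.
  rewrite (ratmap_fin _ pq) ?S_den_neq0 //; last by rewrite hornerC oner_neq0.
  by rewrite !hornerE zE; congr (fin _); field.
have dz := S_den_strange_neq0 A0 A1 h.
rewrite (ratmap_fin _ erefl dz) ?S_den_neq0 //; congr (fin _).
apply: (canLR (mulfK dz)); rewrite S_numE S_denE.
apply/eqP; rewrite -subr_eq0; apply/eqP.
rewrite [LHS](_ : _ = z * (z - 1) * strange_quadratic A z).
  by rewrite h mulr0.
by rewrite /strange_quadratic; ring.
Qed.

(** A = 0 is a genuine exception: the common factor z + 1 then vanishes at the
    strange fixed point. *)
Lemma is_derive_S_strange A z : A != 0 -> A != 1 ->
    strange_quadratic A z = 0 ->
  is_derive z (1 : K) (affine (S_map A)) ((6 * A - 5) / (A - 1)).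
Proof.
move=> A0 A1 h; have dz := S_den_strange_neq0 A0 A1 h.
have A1' : A - 1 != 0 by rewrite subr_eq0.
apply: is_derive_eq (is_derive_affine_ratmap (S_den_neq0 A1) erefl dz) _.
apply/eqP; rewrite eqr_div ?expf_neq0 // deriv_S_numE deriv_S_denE S_numE S_denE.
rewrite -subr_eq0; apply/eqP.
(* with q the quadratic, a = A - 1, c = 2A - 1 and A = c - a: the numerator
   of S' is z^2 (3 c q + z (4a + c) (a - c)), and the square of the denominator
   is q (q - 2 a z (z + 1)) + a z^2 (q + z (a - c)); the terms free of q cancel
   in the cross product, which leaves this cofactor *)
rewrite [LHS](_ : _ = (3 * (A - 1) * (2 * A - 1) * z ^+ 2
    - (6 * A - 5) * (strange_quadratic A z
        - 2 * (A - 1) * z * (z + 1) + (A - 1) * z ^+ 2))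
    * strange_quadratic A z).
  by rewrite h mulr0.
by rewrite /strange_quadratic; ring.
Qed.

Lemma strange_multiplier A z (P : K -> Prop) : A != 0 -> A != 1 ->
    strange_quadratic A z = 0 -> P ((6 * A - 5) / (A - 1)) ->
  fixed_point_multiplier (S_map A) z P.
Proof.
move=> A0 A1 h; have [dS dSE] := is_derive_S_strange A0 A1 h.
by split; [exact: S_fixed_strange | exact: dS | rewrite derive1E dSE].
Qed.

Lemma strange_fixed_point_quadratic A z : A != 1 -> strange_quadratic A z = 0 ->
  strange_fixed_point (S_map A) (fin z).
Proof.
move=> A1 h; split => //; first exact: S_fixed_strange.
by case=> z0; move: (strange_quadratic_neq0 A1 h); rewrite z0 eqxx.
Qed.

(** At A = 0 and A = 1 the distance to 29/35 is 29/35 and 6/35. *)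
Lemma disk_neq01 A : `|A - 29 / 35| <= 1 / 35 -> A != 0 /\ A != 1.
Proof.
move=> hA; split; apply: contraTneq hA => ->.
  rewrite sub0r normrN ger0_norm ?divr_ge0 // ler_pM2r ?invr_gt0 //.
  by rewrite (ler_nat _ 29 1).
have -> : 1 - 29 / 35 = 6 / 35 :> K by field.
rewrite ger0_norm ?divr_ge0 // ler_pM2r ?invr_gt0 //.
by rewrite (ler_nat _ 6 1).
Qed.

End StrangeFixedPoints.

(** * The Apollonius circle of the parameter plane *)

Section MultiplierNorm.
Local Set Implicit Arguments.
Local Unset Strict Implicit.
Variable C : numClosedFieldType.
Implicit Type A : C.

(** The points whose distances to 5/6 and 1 are in the ratio 1/6 form a circle;
    expanding the squared moduli as w times its conjugate gives its centre
    29/35 and radius 1/35, because 29^2 - 24 * 35 = 1. *)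
Lemma multiplier_normE A :
  `|6 * A - 5| ^+ 2 - `|A - 1| ^+ 2 =
  35 * (`|A - 29 / 35| ^+ 2 - (1 / 35) ^+ 2).
Proof.
rewrite !normCK !rmorphB !rmorphM /= fmorphV !rmorph_nat rmorph1.
by field.
Qed.

(** Nonnegative elements compare as their squares, and the difference of the
    squares keeps its sign under multiplication by k. *)
Lemma cmp_of_sqr_sub (k x y u v : C) :
    0 < k -> 0 <= x -> 0 <= y -> 0 <= u -> 0 <= v ->
    x ^+ 2 - y ^+ 2 = k * (u ^+ 2 - v ^+ 2) ->
  [/\ (x < y) = (u < v), (x == y) = (u == v) & (y < x) = (v < u)].
Proof.
move=> k0 x0 y0 u0 v0 E.
have ltE (a b : C) : 0 <= a -> 0 <= b -> (a < b) = (a ^+ 2 < b ^+ 2).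
  by move=> a0 b0; rewrite ltr_pXn2r.
have eqE (a b : C) : 0 <= a -> 0 <= b -> (a == b) = (a ^+ 2 == b ^+ 2).
  by move=> a0 b0; rewrite eqrXn2.
rewrite (ltE x y) // (ltE u v) // (ltE y x) // (ltE v u) // (eqE x y) //.
rewrite (eqE u v) //; split.
- by rewrite -subr_lt0 E pmulr_rlt0 // subr_lt0.
- by rewrite -subr_eq0 E mulf_eq0 gt_eqF //= subr_eq0.
- by rewrite -subr_gt0 E pmulr_rgt0 // subr_gt0.
Qed.

Lemma multiplier_norm_cmp A : A != 1 ->
  [/\ (`|(6 * A - 5) / (A - 1)| < 1) = (`|A - 29 / 35| < 1 / 35),
      (`|(6 * A - 5) / (A - 1)| == 1) = (`|A - 29 / 35| == 1 / 35)
    & (1 < `|(6 * A - 5) / (A - 1)|) = (1 / 35 < `|A - 29 / 35|)].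
Proof.
move=> A1; have a0 : 0 < `|A - 1| by rewrite normr_gt0 subr_eq0.
have r0 : 0 <= 1 / 35 :> C by rewrite divr_ge0.
(* 1 / 35 is generalized so that the rewriting rules on quotients only act on
   the multiplier *)
have := multiplier_normE A; move: (1 / 35) r0 => r r0 E.
rewrite normf_div ltr_pdivrMr // ltr_pdivlMr // !mul1r.
rewrite -[_ / _ == 1](inj_eq (mulIf (lt0r_neq0 a0))) divfK ?lt0r_neq0 // mul1r.
exact: cmp_of_sqr_sub E.
Qed.

End MultiplierNorm.

Theorem theorem2p4 (R : realType) (A s z2 z3 : R[i])
    (hs : s ^+ 2 = A * (5 * A - 4))
    (hz2 : z2 = (3 * A - 2 + s) / (2 * (1 - A)))
    (hz3 : z3 = (3 * A - 2 - s) / (2 * (1 - A))) :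
  (A <> 1 ->
     strange_fixed_point (S_map A) (fin z2) /\
     strange_fixed_point (S_map A) (fin z3)) /\
  ((`|A - 29 / 35| < 1 / 35 ->
      attractor (S_map A) z2 /\ attractor (S_map A) z3) /\
   (A = 5 / 6 ->
      superattractor (S_map A) z2 /\ superattractor (S_map A) z3)) /\
  (`|A - 29 / 35| = 1 / 35 ->
     parabolic (S_map A) z2 /\ parabolic (S_map A) z3) /\
  (A <> 0 -> A <> 1 -> 1 / 35 < `|A - 29 / 35| ->
     repulsive (S_map A) z2 /\ repulsive (S_map A) z3).
Proof.
have hs' : (- s) ^+ 2 = A * (5 * A - 4) by rewrite sqrrN.
have q2 : A != 1 -> strange_quadratic A z2 = 0.
  by move=> A1; exact: strange_quadratic_root A1 hs hz2.
have q3 : A != 1 -> strange_quadratic A z3 = 0.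
  by move=> A1; exact: strange_quadratic_root A1 hs' hz3.
have mult (P : R[i] -> Prop) : A != 0 -> A != 1 -> P ((6 * A - 5) / (A - 1)) ->
    fixed_point_multiplier (S_map A) z2 P /\
    fixed_point_multiplier (S_map A) z3 P.
  by move=> A0 A1 hP; split; apply: strange_multiplier => //; auto.
split; [|split; [split|split]].
- by move=> /eqP A1; split; apply: strange_fixed_point_quadratic => //; auto.
- move=> hA; have [A0 A1] := disk_neq01 (ltW hA).
  by apply: mult => //; have [-> _ _] := multiplier_norm_cmp A1.
- move=> hA.
  have A0 : A != 0 by rewrite hA mulf_neq0 ?invr_eq0 ?pnatr_eq0.
  have A1 : A != 1.
    have -> : A = 1 - 6^-1 by rewrite hA; field.
    by rewrite -subr_eq0 addrC addKr oppr_eq0 invr_eq0 pnatr_eq0.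
  apply: mult => //.
  by have -> : 6 * A - 5 = 0; [rewrite hA; field | rewrite mul0r normr0].
- move=> hA; have [A0 A1] : A != 0 /\ A != 1 by apply: disk_neq01; rewrite hA.
  by apply: mult => //; apply/eqP; have [_ -> _] := multiplier_norm_cmp A1; apply/eqP.
- move=> /eqP A0 /eqP A1 hA.
  by apply: mult => //; have [_ _ ->] := multiplier_norm_cmp A1.
Qed.
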